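(* Each two-dimensional subalgebra of $\mathfrak{sp}(4,\mathbb{C})$ whose elements are all nilpotent is conjugate to exactly one of the following inequivalent abelian algebras: $$\langle X_{\alpha},X_{\alpha+\beta}\rangle,\qquad \langle X_{\alpha},X_{\alpha+2\beta}\rangle,\qquad \langle X_{\beta}+X_{\alpha},X_{\alpha+2\beta}\rangle .$$
   Context: Let $J=\begin{pmatrix}0&0&1&0\\0&0&0&1\\-1&0&0&0\\0&-1&0&0\end{pmatrix}$. $\mathfrak{sp}(4,\mathbb{C})$ is the Lie algebra of $4\times4$ complex matrices $X$ with $JX^tJ=X$, and $Sp(4,\mathbb{C})=\{g\in GL(4,\mathbb{C}) : gJg^t=J\}$, acting on $\mathfrak{sp}(4,\mathbb{C})$ by conjugation $X\mapsto gXg^{-1}$. Elements are nilpotent if they are so as matrices. With $E_{ij}$ the matrix units, $X_\alpha=E_{24}$, $X_\beta=E_{12}-E_{43}$, $X_{\alpha+\beta}=E_{14}+E_{23}$, $X_{\alpha+2\beta}=E_{13}$. $\langle\,\cdot\,\rangle$ denotes the complex linear span. Two subalgebras are equivalent (conjugate) if some $g\in Sp(4,\mathbb{C})$ conjugates one onto the other. *)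

(* Defs.v *)
From HB Require Import structures.
From mathcomp Require Import all_boot all_order all_algebra.
From mathcomp Require Import reals complex.
Set Implicit Arguments.
Unset Strict Implicit.
Unset Printing Implicit Defensive.
Import Order.TTheory GRing.Theory Num.Theory.
Local Open Scope ring_scope.
Local Open Scope complex_scope.

(* The complex numbers are R[i] for an arbitrary R : realType. *)

Section Sp4.
Variable R : realType.
Notation C := R[i].

Definition Jmx : 'M[C]_4 :=
  block_mx (0 : 'M[C]_2) 1%:M (- 1%:M) (0 : 'M[C]_2).

Definition in_sp4 (X : 'M[C]_4) : Prop := Jmx *m X^T *m Jmx = X.

Definition in_Sp4 (g : 'M[C]_4) : Prop :=
  g \in unitmx /\ g *m Jmx *m g^T = Jmx.

Definition lie_bracket (X Y : 'M[C]_4) : 'M[C]_4 := X *m Y - Y *m X.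

(* Complex Lie subalgebras of sp(4, C), as C-linear subspaces of 'M[C]_4. *)
Definition sp4_subalgebra (h : {vspace 'M[C]_4}) : Prop :=
  (forall X, X \in h -> in_sp4 X) /\
  (forall X Y, X \in h -> Y \in h -> lie_bracket X Y \in h).

Definition abelian_subalgebra (h : {vspace 'M[C]_4}) : Prop :=
  sp4_subalgebra h /\
  (forall X Y, X \in h -> Y \in h -> lie_bracket X Y = 0).

Definition nilpotent_mx (X : 'M[C]_4) : Prop := exists k : nat, X ^+ k = 0.

Definition all_nilpotent (h : {vspace 'M[C]_4}) : Prop :=
  forall X, X \in h -> nilpotent_mx X.

(* X |-> g X g^-1 *)
Definition conj_lfun (g : 'M[C]_4) : 'End('M[C]_4) :=
  linfun (mulmxr (invmx g) \o mulmx g).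

Lemma conj_lfunE (g X : 'M[C]_4) : conj_lfun g X = g *m X *m invmx g.
Proof. by rewrite lfunE. Qed.

Definition Sp4_conjugate (h1 h2 : {vspace 'M[C]_4}) : Prop :=
  exists g : 'M[C]_4, in_Sp4 g /\ (conj_lfun g @: h1)%VS = h2.

(* Matrix units with 1-based indices 1 <= i, j <= 4. *)
Definition E (i j : nat) : 'M[C]_4 := delta_mx (inord i.-1) (inord j.-1).

Definition X_a : 'M[C]_4 := E 2 4.
Definition X_b : 'M[C]_4 := E 1 2 - E 4 3.
Definition X_ab : 'M[C]_4 := E 1 4 + E 2 3.
Definition X_a2b : 'M[C]_4 := E 1 3.

Definition nil_rep (i : 'I_3) : {vspace 'M[C]_4} :=
  tnth [tuple <<[:: X_a; X_ab]>>%VS;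
              <<[:: X_a; X_a2b]>>%VS;
              <<[:: (X_b + X_a)%R; X_a2b]>>%VS] i.

End Sp4.

(* Main.v *)
(* A two-dimensional Lie algebra of nilpotent matrices is abelian, because a
   bracket relation [W, V] = c V with W nilpotent and c != 0 forces V = 0.
   Matrices act on row vectors, which carry the symplectic form u J v^T.
   - If some X in the algebra has X^3 != 0, a suitable u makes
     u, uX, -uX^3, uX^2 a symplectic basis. In it X becomes X_b + X_a, whose
     centralizer in sp(4) is the third representative.
   - Otherwise X^2 = 0 for all X: X^2 J is alternating, hence of even rank,
     and X^3 = 0 leaves X^2 rank at most 1 in dimension 4. By polarization all
     products vanish, and two independent rows of elements of the algebra span
     a Lagrangian plane killed by the whole algebra. The algebra is then a
     pencil of symmetric 2x2 matrices B under B |-> P B P^T.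
     Such a pencil contains a singular matrix, which can be moved to the span
     of X_a; the pencil is then either tangent to the cone of singular matrices
     (first representative) or secant to it (second representative). *)
Require Import Defs.
From mathcomp Require Import all_boot all_order all_algebra.
From mathcomp Require Import boolp reals complex ring.
Import GRing.Theory Num.Theory.
Local Open Scope ring_scope.
Local Open Scope complex_scope.
Set Implicit Arguments.
Unset Strict Implicit.
Unset Printing Implicit Defensive.

(** * Explicit 2x2 matrices *)

Definition mx22 (T : Type) (a b c d : T) : 'M[T]_2 :=
  \matrix_(i < 2, j < 2)
    if i == 0 :> nat then (if j == 0 :> nat then a else b)
    else (if j == 0 :> nat then c else d).

Lemma ord2_cases (i : 'I_2) : i = 0 \/ i = 1.
Proof. by case: i => [[|[|//]] Hi]; [left|right]; apply: val_inj. Qed.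

Lemma mx22_eta (T : Type) (A : 'M[T]_2) :
  A = mx22 (A 0 0) (A 0 1) (A 1 0) (A 1 1).
Proof.
by apply/matrixP=> i j; rewrite mxE; case: (ord2_cases i) (ord2_cases j)
  => -> [] ->.
Qed.

Lemma mx22_inj (T : Type) (a b c d a' b' c' d' : T) :
  mx22 a b c d = mx22 a' b' c' d' -> [/\ a = a', b = b', c = c' & d = d'].
Proof.
move/matrixP=> eqM.
by split; [have:= eqM 0 0|have:= eqM 0 1|have:= eqM 1 0|have:= eqM 1 1];
  rewrite !mxE.
Qed.

Lemma mul_mx22 (T : pzRingType) (a b c d a' b' c' d' : T) :
  mx22 a b c d *m mx22 a' b' c' d' =
  mx22 (a * a' + b * c') (a * b' + b * d') (c * a' + d * c') (c * b' + d * d').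
Proof.
by apply/matrixP=> i j; rewrite !mxE !big_ord_recl big_ord0 !mxE addr0;
  case: (ord2_cases i) (ord2_cases j) => -> [] ->.
Qed.

Lemma add_mx22 (T : nmodType) (a b c d a' b' c' d' : T) :
  mx22 a b c d + mx22 a' b' c' d' = mx22 (a + a') (b + b') (c + c') (d + d').
Proof.
by apply/matrixP=> i j; rewrite !mxE;
  case: (ord2_cases i) (ord2_cases j) => -> [] ->.
Qed.

Lemma opp_mx22 (T : zmodType) (a b c d : T) :
  - mx22 a b c d = mx22 (- a) (- b) (- c) (- d).
Proof.
by apply/matrixP=> i j; rewrite !mxE;
  case: (ord2_cases i) (ord2_cases j) => -> [] ->.
Qed.

Lemma scale_mx22 (T : pzRingType) (k a b c d : T) :
  k *: mx22 a b c d = mx22 (k * a) (k * b) (k * c) (k * d).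
Proof.
by apply/matrixP=> i j; rewrite !mxE;
  case: (ord2_cases i) (ord2_cases j) => -> [] ->.
Qed.

Lemma tr_mx22 (T : Type) (a b c d : T) : (mx22 a b c d)^T = mx22 a c b d.
Proof.
by apply/matrixP=> i j; rewrite !mxE;
  case: (ord2_cases i) (ord2_cases j) => -> [] ->.
Qed.

Lemma mx22_0 (T : nmodType) : 0 = mx22 0 0 0 0 :> 'M[T]_2.
Proof. by rewrite [LHS]mx22_eta !mxE. Qed.

Lemma mx22_1 (T : pzRingType) : 1%:M = mx22 1 0 0 1 :> 'M[T]_2.
Proof. by rewrite [LHS]mx22_eta !mxE. Qed.

Lemma delta_mx22 (T : pzRingType) :
  ((delta_mx 0 0 = mx22 1 0 0 0 :> 'M[T]_2) *
   (delta_mx 0 1 = mx22 0 1 0 0 :> 'M[T]_2)) *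
  ((delta_mx 1 0 = mx22 0 0 1 0 :> 'M[T]_2) *
   (delta_mx 1 1 = mx22 0 0 0 1 :> 'M[T]_2)).
Proof. by do !split; rewrite [LHS]mx22_eta !mxE. Qed.

Lemma det_mx22 (T : comNzRingType) (a b c d : T) :
  \det (mx22 a b c d) = a * d - b * c.
Proof.
rewrite (expand_det_row _ 0) !big_ord_recl big_ord0 /cofactor !det_mx11 !mxE /=.
by rewrite addr0 !expr0 !expr1 !mul1r mulN1r mulrN.
Qed.

(** Splits the four indices as 2 + 2, so that each matrix unit falls into one of the four 2x2
    blocks. *)
Lemma inord4 :
  ((inord 0 = lshift 2 (0 : 'I_2) :> 'I_4) *
   (inord 1 = lshift 2 (1 : 'I_2) :> 'I_4)) *
  ((inord 2 = rshift 2 (0 : 'I_2) :> 'I_4) *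
   (inord 3 = rshift 2 (1 : 'I_2) :> 'I_4)).
Proof. by do !split; apply: val_inj; rewrite /= inordK. Qed.

Section Sp4Nilpotent.

Variable R : realType.
Local Notation C := R[i].
Local Notation J := (Jmx R).
Local Notation block := (@block_mx C 2 2 2 2).

Implicit Types A B D : 'M[C]_2.

(** * Block arithmetic, the algebra sp(4) and the group Sp(4) *)

Lemma mul_block A B D G A' B' D' G' :
  (block A B D G : 'M_4) *m (block A' B' D' G' : 'M_4) =
  block (A *m A' + B *m D') (A *m B' + B *m G')
        (D *m A' + G *m D') (D *m B' + G *m G').
Proof. exact: (@mulmx_block _ 2 2 2 2 2 2). Qed.

Lemma add_block A B D G A' B' D' G' :
  (block A B D G : 'M_4) + (block A' B' D' G' : 'M_4) =
  block (A + A') (B + B') (D + D') (G + G').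
Proof. exact: (@add_block_mx _ 2 2 2 2). Qed.

Lemma opp_block A B D G :
  - (block A B D G : 'M_4) = block (- A) (- B) (- D) (- G).
Proof. exact: (@opp_block_mx _ 2 2 2 2). Qed.

Lemma scale_block k A B D G :
  k *: (block A B D G : 'M_4) = block (k *: A) (k *: B) (k *: D) (k *: G).
Proof. exact: (@scale_block_mx _ 2 2 2 2). Qed.

Lemma tr_block A B D G :
  (block A B D G : 'M_4)^T = block A^T D^T B^T G^T.
Proof. exact: (@tr_block_mx _ 2 2 2 2). Qed.

Lemma block_0 : 0 = block 0 0 0 0 :> 'M_4.
Proof. by rewrite /block_mx !row_mx0 col_mx0. Qed.

Lemma block_1 : 1%:M = block 1%:M 0 0 1%:M :> 'M_4.
Proof. exact: (@scalar_mx_block _ 2 2). Qed.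

Lemma block_inj A B D G A' B' D' G' :
  block A B D G = block A' B' D' G' :> 'M_4 ->
  [/\ A = A', B = B', D = D' & G = G'].
Proof. exact: (@eq_block_mx _ 2 2 2 2). Qed.

Lemma block_eta (X : 'M[C]_4) : exists A B D G, X = block A B D G.
Proof. by do 4!eexists; rewrite -[LHS](@submxK _ 2 2 2 2). Qed.

Lemma X_a_block : X_a R = block 0 (mx22 0 0 0 1) 0 0.
Proof.
rewrite /X_a /E !inord4 (@delta_mx_ushift _ 2 2 4) (@delta_mx_rshift _ 2 2 2).
by rewrite delta_mx22 /block_mx row_mx0.
Qed.

Lemma X_ab_block : X_ab R = block 0 (mx22 0 1 1 0) 0 0.
Proof.
rewrite /X_ab /E !inord4 !(@delta_mx_ushift _ 2 2 4).
rewrite !(@delta_mx_rshift _ 2 2 2).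
rewrite !delta_mx22 -{1 2}(@row_mx0 _ 2 2 2) [LHS]add_block.
by rewrite !addr0 add_mx22 !addr0 !add0r.
Qed.

Lemma X_a2b_block : X_a2b R = block 0 (mx22 1 0 0 0) 0 0.
Proof.
rewrite /X_a2b /E !inord4 (@delta_mx_ushift _ 2 2 4) (@delta_mx_rshift _ 2 2 2).
by rewrite delta_mx22 /block_mx row_mx0.
Qed.

Lemma X_b_block : X_b R = block (mx22 0 1 0 0) 0 0 (mx22 0 0 (- 1) 0).
Proof.
rewrite /X_b /E !inord4 (@delta_mx_ushift _ 2 2 4) (@delta_mx_dshift _ 2 2 4).
rewrite (@delta_mx_rshift _ 2 2 2) (@delta_mx_lshift _ 2 2 2) !delta_mx22.
rewrite -{1 2}(@row_mx0 _ 2 2 2) opp_block [LHS]add_block.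
by rewrite !oppr0 !addr0 !add0r opp_mx22 !oppr0.
Qed.

Lemma Jmx_sqr : J *m J = - 1%:M.
Proof.
rewrite /Jmx mul_block !mul0mx !mulmx0 !mul1mx !mulmx1.
rewrite !addr0 !add0r.
by rewrite [in RHS]block_1 opp_block !oppr0.
Qed.

Lemma tr_Jmx : J^T = - J.
Proof.
rewrite /Jmx tr_block opp_block.
by rewrite !trmx0 !oppr0 !linearN /= trmx1 opprK.
Qed.

Lemma in_sp4_block (A B C' D : 'M[C]_2) :
  in_sp4 (block A B C' D) <-> [/\ B^T = B, C'^T = C' & D = - A^T].
Proof.
rewrite /in_sp4 /Jmx tr_block mul_block.
rewrite mul_block !(mulNmx,mulmxN,mul0mx,mulmx0,mul1mx,mulmx1).
rewrite !(add0r, addr0) !opprK; split=> [/block_inj[]|] .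
  by move=> _ -> -> <-.
by case=> -> -> ->; rewrite linearN /= trmxK opprK.
Qed.

Lemma in_sp4E (X : 'M[C]_4) : in_sp4 X <-> X *m J = - (J *m X^T).
Proof.
rewrite /in_sp4; split=> [eqX|eqX].
  by rewrite -{1}eqX -mulmxA Jmx_sqr mulmxN mulmx1.
by rewrite -[J *m _]opprK -eqX mulNmx -mulmxA Jmx_sqr mulmxN mulmx1 opprK.
Qed.

(** Since [J *m J = - 1%:M], the equation exhibits [- (J *m g^T *m J)] as a right inverse of [g]. *)
Lemma in_Sp4P (g : 'M[C]_4) : g *m J *m g^T = J -> in_Sp4 g.
Proof.
move=> gJ; split=> //.
have: g *m (- (J *m g^T *m J)) = 1%:M.
  by rewrite mulmxN !mulmxA gJ Jmx_sqr opprK.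
by case/mulmx1_unit.
Qed.

Lemma in_Sp4_mul (g h : 'M[C]_4) : in_Sp4 g -> in_Sp4 h -> in_Sp4 (g *m h).
Proof.
move=> [_ gJ] [_ hJ]; apply: in_Sp4P.
by rewrite trmx_mul !mulmxA -(mulmxA g) -(mulmxA g) hJ.
Qed.

Lemma in_Sp4_inv (g : 'M[C]_4) : in_Sp4 g -> in_Sp4 (invmx g).
Proof.
move=> [gu gJ]; apply: in_Sp4P.
rewrite -[in LHS]gJ trmx_inv !mulmxA mulVmx // mul1mx -mulmxA mulmxV ?mulmx1 //.
by rewrite unitmx_tr.
Qed.

Lemma conj_lfun_mul (g h X : 'M[C]_4) : g \in unitmx -> h \in unitmx ->
  conj_lfun (g *m h) X = conj_lfun g (conj_lfun h X).
Proof.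
move=> gu hu; rewrite !conj_lfunE.
suff ->: invmx (g *m h) = invmx h *m invmx g by rewrite !mulmxA.
have ghu: g *m h \in unitmx by rewrite unitmx_mul gu.
apply: (can_inj (mulKmx ghu)).
by rewrite mulmxV // mulmxA -(mulmxA g) mulmxV // mulmx1 mulmxV.
Qed.

Lemma conj_lfunK (g : 'M[C]_4) : g \in unitmx ->
  cancel (conj_lfun g) (conj_lfun (invmx g)).
Proof.
move=> gu X; rewrite !conj_lfunE invmxK !mulmxA mulVmx // mul1mx.
by rewrite -mulmxA mulVmx // mulmx1.
Qed.

Lemma conj_lfun_eq (g X Y : 'M[C]_4) :
  g \in unitmx -> g *m X = Y *m g -> conj_lfun g X = Y.
Proof. by move=> gu eqXY; rewrite conj_lfunE eqXY mulmxK. Qed.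

Lemma conj_lfunM (g X Y : 'M[C]_4) : g \in unitmx ->
  conj_lfun g (X *m Y) = conj_lfun g X *m conj_lfun g Y.
Proof. by move=> gu; rewrite !conj_lfunE !mulmxA mulmxKV. Qed.

Lemma in_sp4_conj (g X : 'M[C]_4) : in_Sp4 g -> in_sp4 X ->
  in_sp4 (conj_lfun g X).
Proof.
move=> [gu gJ] /in_sp4E spX; apply/in_sp4E; rewrite conj_lfunE.
have gtu : g^T \in unitmx by rewrite unitmx_tr.
have eqJ : invmx g *m J = J *m g^T.
  by rewrite -[in LHS]gJ !mulmxA mulVmx ?mul1mx.
rewrite -mulmxA eqJ !trmx_mul trmx_inv -!mulmxA [X *m (_ *m _)]mulmxA.
rewrite spX mulNmx mulmxN.
congr (- _); rewrite -{2}gJ -!mulmxA; do 2!congr (_ *m _).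
by rewrite mulKVmx.
Qed.

Lemma Sp4_conjugate_trans (h1 h2 h3 : {vspace 'M[C]_4}) :
  Sp4_conjugate h1 h2 -> Sp4_conjugate h2 h3 -> Sp4_conjugate h1 h3.
Proof.
case=> g [gS <-] [g' [gS' <-]]; exists (g' *m g); split;
  first exact: in_Sp4_mul.
rewrite -limg_comp; congr (_ @: _)%VS; apply/lfunP=> X.
by rewrite comp_lfunE conj_lfun_mul //; [case: gS'|case: gS].
Qed.

Lemma Sp4_conjugate_sym (h1 h2 : {vspace 'M[C]_4}) :
  Sp4_conjugate h1 h2 -> Sp4_conjugate h2 h1.
Proof.
case=> g [gS <-]; exists (invmx g); split; first exact: in_Sp4_inv.
rewrite -limg_comp -[RHS]lim1g; congr (_ @: _)%VS; apply/lfunP=> X.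
by rewrite comp_lfunE id_lfunE conj_lfunK //; case: gS.
Qed.

Lemma dim_conj (g : 'M[C]_4) (h : {vspace 'M[C]_4}) : g \in unitmx ->
  \dim (conj_lfun g @: h) = \dim h.
Proof.
move=> gu; apply: limg_dim_eq.
suff /eqP-> : lker (conj_lfun g) == 0%VS by rewrite capv0.
by apply/lker0P; apply: can_inj (conj_lfunK gu).
Qed.

Lemma Sp4_conjugateP (g : 'M[C]_4) (h k : {vspace 'M[C]_4}) :
  in_Sp4 g -> \dim h = \dim k ->
  (forall X, X \in h -> conj_lfun g X \in k) -> Sp4_conjugate h k.
Proof.
move=> gS eqdim hk; exists g; split=> //; apply/eqP.
rewrite eqEdim dim_conj ?eqdim ?leqnn ?andbT; last by case: gS.
by apply/subvP=> _ /memv_imgP[X hX ->]; apply: hk.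
Qed.

(** * Planes spanned by two matrices *)

Lemma memv_span2P (X Y Z : 'M[C]_4) :
  reflect (exists a b : C, Z = a *: X + b *: Y) (Z \in <<[:: X; Y]>>%VS).
Proof.
rewrite span_cons span_seq1; apply: (iffP memv_addP).
  by case=> _ /vlineP[a ->] [_ /vlineP[b ->]] ->; exists a, b.
case=> a [b ->]; exists (a *: X); first by apply/vlineP; exists a.
by exists (b *: Y) => //; apply/vlineP; exists b.
Qed.

Lemma dim_span2 (X Y : 'M[C]_4) :
  (forall a b : C, a *: X + b *: Y = 0 -> a = 0 /\ b = 0) ->
  \dim <<[:: X; Y]>>%VS = 2%N.
Proof.
move=> indXY; suff: free [:: X; Y] by move/eqP.
rewrite free_cons span_seq1 seq1_free; apply/andP; split.
  apply/negP=> /vlineP[k Xk].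
  have [] := indXY 1 (- k) _; first by rewrite scale1r scaleNr -Xk subrr.
  by move/eqP; rewrite oner_eq0.
apply/eqP=> Y0; have [|_ /eqP] := indXY 0 1; last by rewrite oner_eq0.
by rewrite Y0 scaler0 scale0r addr0.
Qed.

Lemma span2_extend (h : {vspace 'M[C]_4}) (Z : 'M[C]_4) :
  \dim h = 2%N -> Z \in h -> Z != 0 ->
  exists2 Y, h = <<[:: Z; Y]>>%VS & Y \notin <[Z]>%VS.
Proof.
move=> dimh Zh Z0.
have [Y Yh YZ] : exists2 Y, Y \in h & Y \notin <[Z]>%VS.
  apply: contrapT => noY; have /dimvS : (h <= <[Z]>)%VS.
    apply/subvP=> Y Yh; apply/negPn/negP => YZ; apply: noY; by exists Y.
  by rewrite dimh dim_vline Z0.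
exists Y => //; apply/esym/eqP; rewrite eqEdim; apply/andP; split.
  apply/span_subvP=> X; rewrite !inE => /orP[]/eqP-> //.
rewrite dimh; have -> // : \dim <<[:: Z; Y]>>%VS = 2%N.
apply/eqP; rewrite -/(free [:: Z; Y]).
rewrite -(@perm_free _ _ [:: Y; Z]) ?(perm_catC [::Y] [:: Z]) //.
by rewrite free_cons span_seq1 seq1_free YZ.
Qed.

(** * The three representatives in coordinates *)

Lemma ord3_cases (P : 'I_3 -> Prop) : P 0 -> P 1 -> P ord_max -> forall i, P i.
Proof.
move=> P0 P1 P2 [[|[|[|//]]] lti]; [move: P0|move: P1|move: P2];
  by congr P; apply: val_inj.
Qed.

Ltac block_ring :=
  rewrite ?(mx22_1, mx22_0) ?(scale_block, opp_block, add_block, mul_block);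
  rewrite ?(scale_mx22, opp_mx22, tr_mx22, mul_mx22, add_mx22);
  by congr (block_mx (mx22 _ _ _ _) (mx22 _ _ _ _) (mx22 _ _ _ _)
                     (mx22 _ _ _ _)); ring.

Lemma mem_nil_rep0 (X : 'M[C]_4) :
  X \in nil_rep R 0 <-> exists a b, X = block 0 (mx22 0 b b a) 0 0.
Proof.
have eqX a b : a *: X_a R + b *: X_ab R = block 0 (mx22 0 b b a) 0 0.
  rewrite X_a_block X_ab_block; block_ring.
split=> [/memv_span2P[a [b ->]]|[a [b ->]]]; first by exists a, b.
by apply/memv_span2P; exists a, b.
Qed.

Lemma mem_nil_rep1 (X : 'M[C]_4) :
  X \in nil_rep R 1 <-> exists a b, X = block 0 (mx22 b 0 0 a) 0 0.
Proof.
have eqX a b : a *: X_a R + b *: X_a2b R = block 0 (mx22 b 0 0 a) 0 0.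
  rewrite X_a_block X_a2b_block; block_ring.
split=> [/memv_span2P[a [b ->]]|[a [b ->]]]; first by exists a, b.
by apply/memv_span2P; exists a, b.
Qed.

Lemma mem_nil_rep2 (X : 'M[C]_4) :
  X \in nil_rep R ord_max <->
  exists a b, X = block (mx22 0 a 0 0) (mx22 b 0 0 a) 0 (mx22 0 0 (- a) 0).
Proof.
have eqX a b : a *: (X_b R + X_a R) + b *: X_a2b R =
    block (mx22 0 a 0 0) (mx22 b 0 0 a) 0 (mx22 0 0 (- a) 0).
  rewrite X_a_block X_b_block X_a2b_block; block_ring.
split=> [/memv_span2P[a [b ->]]|[a [b ->]]]; first by exists a, b.
by apply/memv_span2P; exists a, b.
Qed.

Lemma dim_nil_rep i : \dim (nil_rep R i) = 2%N.
Proof.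
elim/ord3_cases: i; apply: dim_span2 => a b; rewrite ?X_a_block ?X_ab_block
  ?X_b_block ?X_a2b_block !(scale_block, opp_block, add_block) block_0;
  rewrite ?(mx22_1, mx22_0) ?(scale_mx22, opp_mx22, add_mx22);
  move=> /block_inj[e1 e2 _ _];
  have [_ q1 _ _] := mx22_inj e1; have [q2 q3 _ q4] := mx22_inj e2;
  by move: q1 q2 q3 q4; rewrite ?(oppr0, mulr0, mulr1, addr0, add0r).
Qed.

Lemma nil_rep_mul_comm i (X Y : 'M[C]_4) :
  X \in nil_rep R i -> Y \in nil_rep R i -> X *m Y = Y *m X.
Proof.
elim/ord3_cases: i.
- move=> /mem_nil_rep0[a [b ->]] /mem_nil_rep0[a' [b' ->]]; block_ring.
- move=> /mem_nil_rep1[a [b ->]] /mem_nil_rep1[a' [b' ->]]; block_ring.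
- move=> /mem_nil_rep2[a [b ->]] /mem_nil_rep2[a' [b' ->]]; block_ring.
Qed.

Lemma in_sp4_nil_rep i (X : 'M[C]_4) : X \in nil_rep R i -> in_sp4 X.
Proof.
elim/ord3_cases: i.
- move=> /mem_nil_rep0[a [b ->]]; apply/in_sp4_block.
  by rewrite !trmx0 oppr0 tr_mx22.
- move=> /mem_nil_rep1[a [b ->]]; apply/in_sp4_block.
  by rewrite !trmx0 oppr0 tr_mx22.
- move=> /mem_nil_rep2[a [b ->]]; apply/in_sp4_block.
  by rewrite !trmx0 !tr_mx22 opp_mx22 !oppr0.
Qed.

Lemma nil_rep_sqr0 i (X : 'M[C]_4) : i != ord_max -> X \in nil_rep R i ->
  X *m X = 0.
Proof.
elim/ord3_cases: i => // _.
- move=> /mem_nil_rep0[a [b ->]]; rewrite block_0; block_ring.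
- move=> /mem_nil_rep1[a [b ->]]; rewrite block_0; block_ring.
Qed.

Lemma nil_rep_nilpotent i : all_nilpotent (nil_rep R i).
Proof.
move=> X Xi; exists 4%N; move: Xi.
have -> : X ^+ 4 = X *m X *m (X *m X) by rewrite -[RHS](exprD X 2 2).
have [->|nei] := eqVneq i ord_max; last first.
  by move/nil_rep_sqr0=> -> //; rewrite mul0mx.
move/mem_nil_rep2=> [a [b ->]]; rewrite [RHS]block_0; block_ring.
Qed.

Lemma nil_rep_abelian i : abelian_subalgebra (nil_rep R i).
Proof.
have br0 X Y : X \in nil_rep R i -> Y \in nil_rep R i -> lie_bracket X Y = 0.
  by move=> Xi Yi; rewrite /lie_bracket (nil_rep_mul_comm Xi Yi) subrr.
split=> //; split=> [X|X Y Xi Yi]; first exact: in_sp4_nil_rep.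
by rewrite br0 // mem0v.
Qed.

(** * Inequivalence of the representatives *)

Lemma nil_rep2_sqr_neq0 :
  exists2 X, X \in nil_rep R ord_max & X *m X != 0.
Proof.
exists (block (mx22 0 1 0 0) (mx22 0 0 0 1) 0 (mx22 0 0 (- 1) 0)).
  by apply/mem_nil_rep2; exists 1, 0.
apply/eqP; rewrite mul_block block_0 mx22_0 !(mul_mx22, add_mx22).
move=> /block_inj[_ e _ _]; have [_ + _ _] := mx22_inj e.
by rewrite !(mulr0, mulr1, addr0, add0r) => /eqP; rewrite oner_eq0.
Qed.

Lemma mxrank_conj (g X : 'M[C]_4) : g \in unitmx ->
  \rank (conj_lfun g X) = \rank X.
Proof.
move=> gu; rewrite conj_lfunE mxrankMfree ?row_free_unit ?unitmx_inv //.
rewrite -mxrank_tr trmx_mul mxrankMfree ?mxrank_tr //.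
by rewrite row_free_unit unitmx_tr.
Qed.

Lemma mxrank_block_ur B : \rank (block 0 B 0 0 : 'M_4) = \rank B.
Proof.
by rewrite /block_mx row_mx0 (@rank_col_mx0 _ 2 4 2) (@rank_row_0mx _ 2 2 2).
Qed.

(* In [nil_rep 1] the elements of rank at most 1 span the algebra; in
   [nil_rep 0] they all lie on one line. *)
Lemma nil_rep01_not_conjugate : ~ Sp4_conjugate (nil_rep R 0) (nil_rep R 1).
Proof.
case=> g [[gu _] eqg].
have line Z : Z \in nil_rep R 1 -> (\rank Z <= 1)%N ->
    exists a : C, Z = a *: conj_lfun g (block 0 (mx22 0 0 0 1) 0 0).
  rewrite -eqg => /memv_imgP[X /mem_nil_rep0[a [b ->]] ->].
  rewrite mxrank_conj // mxrank_block_ur => rk.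
  exists a; rewrite -linearZ scale_block scale_mx22 !scaler0 !mulr0 mulr1.
  suff -> : b = 0 by [].
  (* The symmetric block has determinant [- (b * b)], so rank at most 1 forces [b = 0]. *)
  apply: contraTeq rk => b0; rewrite mxrank_unit // unitmxE det_mx22.
  by rewrite mul0r sub0r unitfE oppr_eq0 mulf_neq0.
have [||a eqa] := line (block 0 (mx22 0 0 0 1) 0 0).
- by apply/mem_nil_rep1; exists 1, 0.
- by rewrite mxrank_block_ur -delta_mx22 mxrank_delta.
have [||b eqb] := line (block 0 (mx22 1 0 0 0) 0 0).
- by apply/mem_nil_rep1; exists 0, 1.
- by rewrite mxrank_block_ur -delta_mx22 mxrank_delta.
(* Both matrices are multiples of one and the same matrix. Cross-multiplying and comparing upper
   left entries gives [a = 0], and then the first matrix would vanish. *)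
have: a *: block 0 (mx22 1 0 0 0) 0 0 = b *: block 0 (mx22 0 0 0 1) 0 0 :> 'M_4.
  by rewrite eqa eqb !scalerA mulrC.
rewrite !scale_block !scale_mx22 => /block_inj[_ e _ _].
have [a0 _ _ _] := mx22_inj e.
move: eqa; rewrite -[a]mulr1 a0 mulr0 scale0r block_0.
rewrite mx22_0 => /block_inj[_ e1 _ _]; have [_ _ _ /eqP] := mx22_inj e1.
by rewrite oner_eq0.
Qed.

(** Conjugation respects products, so an element with nonzero square cannot land in an algebra where
    all squares vanish. *)
Lemma nil_rep_not_conjugate_max i : i != ord_max ->
  ~ Sp4_conjugate (nil_rep R ord_max) (nil_rep R i).
Proof.
move=> ni [g [[gu _] eqg]]; case: nil_rep2_sqr_neq0 => X X2 /eqP[].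
have /(nil_rep_sqr0 ni) : conj_lfun g X \in nil_rep R i.
  by rewrite -eqg memv_img.
rewrite -conj_lfunM // => /(congr1 (conj_lfun (invmx g))).
by rewrite conj_lfunK // linear0.
Qed.

Lemma nil_rep_not_conjugate (i j : 'I_3) : i <> j ->
  ~ Sp4_conjugate (nil_rep R i) (nil_rep R j).
Proof.
elim/ord3_cases: i; elim/ord3_cases: j => // _;
  try exact: nil_rep_not_conjugate_max; try exact: nil_rep01_not_conjugate;
  move/Sp4_conjugate_sym;
  try exact: nil_rep_not_conjugate_max; exact: nil_rep01_not_conjugate.
Qed.

(** * Commutativity of a plane of nilpotent matrices *)

Lemma nilpotent_sub_scalar_unit (W : 'M[C]_4) (c : C) :
  nilpotent_mx W -> c != 0 -> W - c%:M \in unitmx.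
Proof.
(* As [W ^+ k = 0], the factorization of the difference of k-th powers writes the invertible scalar
   [c ^+ k] as a multiple of [c%:M - W]. *)
case=> k Wk c0; have := subrXX_comm k (commr_sym (comm_mx_scalar c W)).
rewrite Wk subr0 -rmorphXn => /(congr1 (fun M => c ^- k *: M)).
rewrite /= -mul_scalar_mx -scalar_mxM mulVf ?expf_neq0 //.
rewrite [RHS](scalemxAr _ (c%:M - W)).
by move=> /esym/mulmx1_unit[]; rewrite -opprB unitrN.
Qed.

Lemma nilpotent_bracket_eigen (W Z : 'M[C]_4) (c : C) :
  nilpotent_mx W -> lie_bracket W Z = c *: Z -> c != 0 -> Z = 0.
Proof.
move=> Wn eqZ c0; have [k Wk] := Wn.
have WZ : (W - c%:M) *m Z = Z *m W.
  rewrite mulmxBl mul_scalar_mx -eqZ /lie_bracket.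
  by rewrite opprB addrC subrK.
(* Iterating the intertwining relation up to the nilpotency exponent kills the right side, while the
   factor in front of [Z] stays invertible. *)
have powZ n : (W - c%:M) ^+ n *m Z = Z *m W ^+ n.
  elim: n => [|n IH]; first by rewrite !expr0 mul1mx mulmx1.
  by rewrite exprSr -mulmxE -mulmxA WZ mulmxA IH -mulmxA [in RHS]exprSr.
have Wcu: (W - c%:M) ^+ k \in unitmx.
  by apply: unitrX; apply: nilpotent_sub_scalar_unit.
by rewrite -(mulKmx Wcu Z) powZ Wk !mulmx0.
Qed.

Lemma nilpotent_dim2_abelian (h : {vspace 'M[C]_4}) :
  sp4_subalgebra h -> \dim h = 2%N -> all_nilpotent h ->
  forall X Y, X \in h -> Y \in h -> X *m Y = Y *m X.
Proof.
move=> [_ brh] dimh nilh X Y Xh Yh; apply/eqP; rewrite -subr_eq0.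
rewrite -/(lie_bracket X Y); apply/negPn/negP=> V0; move: (brh X Y Xh Yh) V0.
move eqV: (lie_bracket X Y) => V Vh V0.
have [W hE _] := span2_extend dimh Vh V0.
have Wh : W \in h by rewrite hE memv_span // !inE eqxx orbT.
move: Xh Yh; rewrite hE => /memv_span2P[a [b eqX]] /memv_span2P[a' [b' eqY]].
(* Up to sign, [k] is the determinant of the coordinates of [X], [Y] in the basis [V], [W]. Hence [V
   = k [W, V]], and [V] is an eigenvector of the bracket with [W] for the eigenvalue [k^-1]. *)
pose k := b * a' - a * b'.
have eqk : V = k *: lie_bracket W V.
  rewrite -{1}eqV /lie_bracket eqX eqY.
  rewrite !(mulmxDl, mulmxDr) -!(scalemxAl, scalemxAr) !scalerA /k.
  rewrite !opprD !scalerBl !scalerBr [a' * a]mulrC.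
  rewrite [b' * b]mulrC [b' * a]mulrC [a' * b]mulrC.
  move: (W *m W) (V *m V) (W *m V) (V *m W) => WW VV WV VW.
  by apply/matrixP=> i j; rewrite !mxE; ring.
have k0 : k != 0 by apply: contra_neq V0; rewrite {1}eqk => ->; rewrite scale0r.
move/negP: V0; apply; apply/eqP.
apply: (nilpotent_bracket_eigen (W := W) (c := k^-1)) => //;
  rewrite ?invr_eq0 //.
  exact: nilh.
by rewrite {2}eqk scalerA mulVf // scale1r.
Qed.

(** * Nilpotency exponent and the symplectic form on row vectors *)

Lemma nilpotent_exp4 (X : 'M[C]_4) : nilpotent_mx X -> X ^+ 4 = 0.
Proof.
case=> k Xk; have: mxminpoly X %| ('X - 0%:P) ^+ k.
  by apply: mxminpoly_min; rewrite subr0 rmorphXn /= horner_mx_X.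
(* The minimal polynomial is a power of the variable up to a unit, and it divides the characteristic
   polynomial, of degree 4. *)
case/dvdp_exp_XsubCP=> m _; rewrite subr0 => pm.
have m4 : (m <= 4)%N.
  have := size_mxminpoly X; rewrite (eqp_size pm) size_polyXn => -[->].
  have := dvdp_leq (monic_neq0 (char_poly_monic X)) (mxminpoly_dvd_char X).
  by rewrite size_mxminpoly size_char_poly.
have Xm : X ^+ m = 0.
  have: mxminpoly X %| 'X^m by rewrite (eqp_dvdl _ pm) dvdpp.
  by move/mxminpoly_minP; rewrite rmorphXn /= horner_mx_X.
have -> : X ^+ 4 = X ^+ (4 - m) * X ^+ m by rewrite -exprD subnK.
by rewrite Xm mulr0.
Qed.

(** With this form on rows, [g *m J *m g^T = J] says that the rows of [g] are a symplectic basis, so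
    conjugating elements can be built row by row. *)
Definition om (u v : 'rV[C]_4) : C := (u *m J *m v^T) 0 0.
Implicit Types u v w : 'rV[C]_4.

Lemma omC u v : om u v = - om v u.
Proof.
have -> : om u v = (u *m J *m v^T)^T 0 0 by rewrite mxE.
by rewrite !trmx_mul trmxK tr_Jmx mulNmx mulmxN mxE mulmxA.
Qed.

Lemma omDl u v w : om (u + v) w = om u w + om v w.
Proof. by rewrite /om !mulmxDl mxE. Qed.

Lemma omZl a u v : om (a *: u) v = a * om u v.
Proof. by rewrite /om -!scalemxAl mxE. Qed.

Lemma omDr u v w : om u (v + w) = om u v + om u w.
Proof. by rewrite omC omDl opprD -!omC. Qed.

Lemma omZr a u v : om u (a *: v) = a * om u v.
Proof. by rewrite omC omZl -mulrN -omC. Qed.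

Lemma om_sp4 (X : 'M[C]_4) u v : in_sp4 X -> om (u *m X) v = - om u (v *m X).
Proof.
move/in_sp4E=> eqX.
by rewrite /om -(mulmxA u) eqX mulmxN mulNmx mxE trmx_mul !mulmxA.
Qed.

Lemma om_uu u : om u u = 0.
Proof.
by have /eqP := omC u u; rewrite -addr_eq0 -mulr2n mulrn_eq0 /= => /eqP.
Qed.

Lemma om0l u : om 0 u = 0.
Proof. by rewrite /om !mul0mx mxE. Qed.

Lemma om_nondeg u : u != 0 -> exists v, om u v != 0.
Proof.
move=> u0; apply: contrapT => all0; move/negP: u0; apply; apply/eqP.
have uJ : u *m J = 0.
  apply/rowP=> i; rewrite mxE; apply/eqP/negPn/negP => ne0; apply: all0.
  exists (delta_mx 0 i); rewrite /om trmx_delta -colE !mxE.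
  by move: ne0; rewrite mxE.
by rewrite -[u]mulmx1 -[1%:M]opprK -Jmx_sqr mulmxN mulmxA uJ mul0mx oppr0.
Qed.

Lemma mx22_block (a b c d : C) :
  mx22 a b c d = @block_mx C 1 1 1 1 a%:M b%:M c%:M d%:M.
Proof.
have e0 : 0 = lshift 1 (0 : 'I_1) :> 'I_2 by apply: val_inj.
have e1 : 1 = rshift 1 (0 : 'I_1) :> 'I_2 by apply: val_inj.
rewrite [RHS]mx22_eta e0 e1 (@block_mxEul _ 1 1 1 1) (@block_mxEur _ 1 1 1 1).
by rewrite (@block_mxEdl _ 1 1 1 1) (@block_mxEdr _ 1 1 1 1) !mxE.
Qed.

Lemma mul_mx22_col n (a b c d : C) (u v : 'rV[C]_n) :
  mx22 a b c d *m (col_mx u v : 'M_(2, n)) =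
  col_mx (a *: u + b *: v) (c *: u + d *: v).
Proof.
by rewrite mx22_block [LHS](@mul_block_col _ 1 1 1 1 n) !mul_scalar_mx.
Qed.

Lemma col_om u v u' v' :
  (col_mx u v : 'M_(2, 4)) *m J *m (col_mx u' v' : 'M_(2, 4))^T =
  mx22 (om u u') (om u v') (om v u') (om v v').
Proof.
rewrite (@tr_col_mx _ 1 1 4) (@mul_col_mx _ 1 1 4 4).
rewrite [LHS](@mul_col_row _ 1 1 4 1 1) mx22_block /om.
by rewrite -!mx11_scalar.
Qed.

(** Three blocks of the Gram matrix of the rows suffice: the fourth is minus the transpose of the
    upper right one. *)
Lemma in_Sp4_col (M N : 'M[C]_(2, 4)) :
  M *m J *m M^T = 0 -> M *m J *m N^T = 1%:M -> N *m J *m N^T = 0 ->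
  in_Sp4 (col_mx M N : 'M_4).
Proof.
move=> MM MN NN; apply: in_Sp4P.
rewrite (@tr_col_mx _ 2 2 4) (@mul_col_mx _ 2 2 4 4).
rewrite (@mul_col_mx _ 2 2 4 4) !(@mul_mx_row _ 2 4 2 2).
rewrite MM MN NN; apply: (congr1 (fun A => block 0 1%:M A 0)).
have /(congr1 (fun A => - A^T)) := MN; rewrite trmx1 => <-.
by rewrite !trmx_mul trmxK tr_Jmx mulNmx mulmxN opprK mulmxA.
Qed.

(** * The regular nilpotent case *)

Lemma regular_nilpotent_witness (X : 'M[C]_4) : in_sp4 X ->
  X *m X *m X != 0 -> exists u, om u (u *m X *m X *m X) != 0.
Proof.
move=> spX X3; apply: contrapT => all0.
(* The cube of [X] is skew-adjoint, so [om u (v *m X *m X *m X)] is symmetric in [u] and [v]. If it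
   vanishes on the diagonal, polarization makes it vanish everywhere, and nondegeneracy gives
   [X *m X *m X = 0]. *)
have om0 u : om u (u *m X *m X *m X) = 0.
  by apply/eqP/negPn/negP=> ne0; apply: all0; exists u.
move/negP: X3; apply; apply/eqP/row_matrixP=> i; rewrite row0.
apply/eqP/negPn/negP=> /om_nondeg[v /negP[]]; rewrite rowE !mulmxA.
have := om0 (delta_mx 0 i + v).
rewrite !mulmxDl !omDl !omDr !om0 add0r addr0.
rewrite [X in _ + X]omC !om_sp4 // !opprK => /eqP.
by rewrite oppr_eq0 -mulr2n mulrn_eq0.
Qed.

Lemma regular_nilpotent_conj (X : 'M[C]_4) : in_sp4 X -> nilpotent_mx X ->
  X *m X *m X != 0 ->
  exists2 g, in_Sp4 g & conj_lfun g X =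
    block (mx22 0 1 0 0) (mx22 0 0 0 1) 0 (mx22 0 0 (- 1) 0).
Proof.
move=> spX /nilpotent_exp4 X4 X3.
have uX4 u : u *m X *m X *m X *m X = 0.
  suff: X ^+ 4 = X *m X *m X *m X by rewrite -!mulmxA => <-; rewrite X4 mulmx0.
  by rewrite !exprSr expr0 mul1r.
have [u0 u0X] := regular_nilpotent_witness spX X3.
(* [X *m X] is self-adjoint while the form is alternating. *)
have om_sqr v : om v (v *m X *m X) = 0.
  apply/eqP; have /eqP := omC v (v *m X *m X).
  by rewrite !om_sp4 // opprK -addr_eq0 -mulr2n mulrn_eq0.
have [u1 u1X] : exists u1, om u1 (u1 *m X *m X *m X) = -1.
  (* Rescaling by [s] multiplies the value by [s ^+ 2], which normalizes it to -1. *)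
  pose s : C := sqrtC (- (om u0 (u0 *m X *m X *m X))^-1).
  exists (s *: u0); rewrite -!scalemxAl omZl omZr mulrA -expr2 sqrtCK mulNr.
  by rewrite mulVf.
(* Adding [t *: (u1 *m X *m X)] to [u1] changes [om u1 (u1 *m X)] by [- 2 t] and leaves the value -1
   intact, so this [t] makes [u] orthogonal to [u *m X]. *)
have [t ht] : exists t : C, t = om u1 (u1 *m X) / 2%:R by eexists.
have [u uE] : exists u, u = u1 + t *: (u1 *m X *m X) by eexists.
have uX : u *m X = u1 *m X + t *: (u1 *m X *m X *m X).
  by rewrite uE mulmxDl -scalemxAl.
have uX2 : u *m X *m X = u1 *m X *m X.
  by rewrite uX mulmxDl -scalemxAl uX4 scaler0 addr0.
have om34 v : om (v *m X *m X) (v *m X *m X *m X) = 0.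
  by rewrite om_sp4 // uX4 omC om0l !oppr0.
have uX0 : om u (u *m X) = 0.
  rewrite uX uE !(omDl, omDr, omZl, omZr) u1X om34.
  rewrite [om (u1 *m X *m X) (u1 *m X)]omC [om (u1 *m X) _]om_sp4 // u1X ht.
  by field.
have uX3 : om u (u *m X *m X *m X) = -1.
  by rewrite uX2 {1}uE omDl omZl om34 u1X mulr0 addr0.
have oN v w : om v (- w) = - om v w by rewrite -scaleN1r omZr mulN1r.
have Nn v w : om (- v) w = - om v w by rewrite omC oN opprK omC.
have gS : in_Sp4 (col_mx (col_mx u (u *m X) : 'M_(2, 4))
  (col_mx (- (u *m X *m X *m X)) (u *m X *m X) : 'M_(2, 4)) : 'M_4).
  apply: in_Sp4_col; rewrite col_om ?mx22_0 ?mx22_1; congr mx22;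
    rewrite ?(om_uu, oN, Nn, oppr0, om_sqr, uX0, uX3, opprK) //.
  - by rewrite omC uX0 oppr0.
  - by rewrite om_sp4 // uX3 opprK.
  - by rewrite omC om34 !oppr0.
  - by rewrite om34 oppr0.
exists (col_mx (col_mx u (u *m X) : 'M_(2, 4))
  (col_mx (- (u *m X *m X *m X)) (u *m X *m X) : 'M_(2, 4)) : 'M_4) => //.
apply: conj_lfun_eq; first by case: gS.
rewrite (@mul_col_mx _ 2 2 4 4) (@mul_block_col _ 2 2 2 2 4).
rewrite !mul_mx22_col mul0mx add0r.
rewrite (@mul_col_mx _ 1 1 4 4) (@mul_col_mx _ 1 1 4 4).
rewrite (@add_col_mx _ 1 1 4) mulNmx uX4.
rewrite !(scale0r, scale1r, scaleN1r, add0r, addr0).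
by rewrite opprK oppr0.
Qed.

(** Comparing the entries of the two products leaves two free parameters, those of the third
    representative. Two of the entries vanish because their doubles do. *)
Lemma regular_nilpotent_centralizer (Y : 'M[C]_4) :
  let N := block (mx22 0 1 0 0) (mx22 0 0 0 1) 0 (mx22 0 0 (- 1) 0) in
  in_sp4 Y -> Y *m N = N *m Y -> Y \in nil_rep R ord_max.
Proof.
move=> N; have [A [B [D [G ->]]]] := block_eta Y => /in_sp4_block[BT _ ->].
move: BT; rewrite (mx22_eta A) (mx22_eta B) (mx22_eta D).
move: (A 0 0) (A 0 1) (A 1 0) (A 1 1) (B 0 0) (B 0 1) (B 1 0) (B 1 1)
  (D 0 0) (D 0 1) (D 1 0) (D 1 1) => a b c d p q q' r k l m n.
rewrite tr_mx22 => BT; have [_ -> _ _] := mx22_inj BT.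
rewrite {BT} /N mx22_0 tr_mx22 opp_mx22.
rewrite !mul_block !mul_mx22 !add_mx22 => /block_inj[e1 e2 e3 e4].
move: (mx22_inj e1) (mx22_inj e2) (mx22_inj e3) (mx22_inj e4).
rewrite !(mulr0, mul0r, mulr1, mul1r, addr0, add0r, mulrN, mulNr, oppr0, opprK).
case=> <- <- <- _ [/eqP qN -> _ /eqP dN] [_ -> _ _] [_ -> _ ->].
have q0 : q = 0 by apply/eqP; rewrite eq_sym -addr_eq0 -mulr2n mulrn_eq0 in qN.
move: dN; rewrite -addr_eq0 -mulr2n mulrn_eq0 /= => /eqP ->.
by rewrite q0 !oppr0; apply/mem_nil_rep2; exists r, p; rewrite mx22_0.
Qed.

(** * The square-zero case: a Lagrangian plane killed by the algebra *)

Lemma cube0_sqr0 (X : 'M[C]_4) : in_sp4 X -> X *m X *m X = 0 -> X *m X = 0.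
Proof.
move=> spX X3; apply/eqP/negPn/negP=> X2.
have [i ri] : exists i, row i (X *m X) != 0.
  apply: contrapT => all0; move/negP: X2; apply; apply/eqP/row_matrixP=> i.
  by rewrite row0; apply/eqP/negPn/negP=> ne0; apply: all0; exists i.
set r := row i _ in ri *.
have rX : (r <= X *m X)%MS by apply: row_sub.
(* Rank one case: [X *m X = c *m r]. The alternating form [om (u *m X *m X) w] is then a product of
   two linear forms, which forces the coordinate of [c] at [i] to vanish, against the choice of row
   [i]. *)
have [/submxP[c eqc]|nXr] := boolP (X *m X <= r)%MS.
  have [v rv] := om_nondeg ri.
  have asym u w : (u *m c) 0 0 * om r w = - ((w *m c) 0 0 * om r u).
    have eqom x y : om (x *m X *m X) y = (x *m c) 0 0 * om r y.
      by rewrite -mulmxA eqc mulmxA [x *m c]mx11_scalar mul_scalar_mx omZl !mxE.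
    by rewrite -!eqom (om_sp4 (u *m X)) // om_sp4 // opprK omC.
  have v0 : (v *m c) 0 0 = 0.
    move/eqP: (asym v v); rewrite -addr_eq0 -mulr2n mulrn_eq0 /= mulf_eq0.
    by rewrite (negPf rv) orbF => /eqP.
  have := asym (delta_mx 0 i) v; rewrite v0 mul0r oppr0 => /eqP.
  rewrite mulf_eq0 (negPf rv) orbF => /eqP ci.
  move/negP: ri; apply; rewrite /r rowE eqc mulmxA [_ *m c]mx11_scalar ci.
  by rewrite mul_scalar_mx scale0r.
have rk2 : (1 < \rank (X *m X))%N.
  have /rank_ltmx : (r < X *m X)%MS by rewrite /ltmx rX.
  by rewrite rank_rV ri.
(* The ranks of [X] and [X *m X] add up to at most 4 and the second is at least 2. Both equal 2, the
   row spaces coincide, and [X = A *m (X *m X)] turns [X *m X] into a multiple of the zero cube. *)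
have := mulmx0_rank_max (A := X) (B := X *m X); rewrite mulmxA => /(_ X3) rkX.
have sX : (X *m X <= X)%MS by apply: submxMl.
have /submxP[A eqA] : (X <= X *m X)%MS.
  rewrite -(geq_leqif (mxrank_leqif_sup sX)).
  by move: rk2 rkX; case: (\rank (X *m X)) => [|[|k]] // _;
    case: (\rank X) => [|[|[|n]]] //; rewrite !addnS.
by move/negP: X2; apply; rewrite {1}eqA -!mulmxA (mulmxA X) X3 mulmx0.
Qed.
(** A right inverse of [M] yields rows [N0] dual to those of [M]. Their Gram matrix is
    antisymmetric, say [T + T], and adding [T *m M] cancels it without disturbing the duality. *)
Lemma symplectic_completion (M : 'M[C]_(2, 4)) :
  row_free M -> M *m J *m M^T = 0 -> exists N : 'M[C]_(2, 4),
  in_Sp4 (col_mx N M : 'M_4).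
Proof.
move=> /row_freeP[K MK] MM.
have [N0 NM] : exists N0 : 'M[C]_(2, 4), N0 *m J *m M^T = 1%:M.
  exists (J *m K)^T; rewrite -[RHS]trmx1 -MK !trmx_mul tr_Jmx.
  by rewrite -(mulmxA K^T) mulNmx Jmx_sqr opprK mulmx1.
have MN : M *m J *m N0^T = - 1%:M.
  rewrite -[1%:M]trmx1 -NM !trmx_mul trmxK tr_Jmx.
  by rewrite mulmxA mulmxN mulNmx opprK.
have [T TT NN] : exists2 T : 'M[C]_2, T^T = - T & N0 *m J *m N0^T = T + T.
  exists (2%:R^-1 *: (N0 *m J *m N0^T)).
    rewrite linearZ -scalerN /=; congr (_ *: _).
    by rewrite !trmx_mul trmxK tr_Jmx mulNmx mulmxN mulmxA.
  by rewrite -mulr2n -scaler_nat scalerA divff ?scale1r // pnatr_eq0.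
exists (N0 + T *m M); apply: in_Sp4_col => //.
  have e1 : T *m M *m J *m N0^T = - T by rewrite -!(mulmxA T) MN mulmxN mulmx1.
  have e2 : T *m M *m J *m M^T = 0 by rewrite -!(mulmxA T) MM mulmx0.
  rewrite linearD /= trmx_mul !(mulmxDl, mulmxDr) !mulmxA e1 e2 NM.
  by rewrite mul1mx mul0mx addr0 NN TT addrK subrr.
by rewrite !mulmxDl NM -!(mulmxA T) MM mulmx0 addr0.
Qed.

(** Writing [X = a *m u], the form [om (x *m X) y] is symmetric and a product of two linear forms,
    so these are proportional: [a] is a multiple of [J *m u^T]. *)
Lemma sp4_rank1 (X : 'M[C]_4) u : in_sp4 X -> u != 0 -> (X <= u)%MS ->
  exists k : C, X = k *: (J *m u^T *m u).
Proof.
move=> spX u0 /submxP[a eqX]; have [v uv] := om_nondeg u0.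
exists (- ((v *m a) 0 0 / om u v)); apply/row_matrixP=> i.
have sym w : (w *m a) 0 0 * om u v = (v *m a) 0 0 * om u w.
  have eqom x y : om (x *m X) y = (x *m a) 0 0 * om u y.
    by rewrite eqX mulmxA [x *m a]mx11_scalar mul_scalar_mx omZl !mxE.
  by rewrite -!eqom om_sp4 // omC opprK.
have row_scal w (b : 'cV[C]_4) : w *m (b *m u) = (w *m b) 0 0 *: u.
  by rewrite mulmxA {1}[w *m b]mx11_scalar mul_scalar_mx.
rewrite !rowE -scalemxAr row_scal eqX row_scal scalerA mulmxA -/(om _ u).
by rewrite [om _ u]omC mulrNN mulrAC -sym mulfK.
Qed.

Lemma isotropic_pair_killed (X Y : 'M[C]_4) :
  in_sp4 X -> in_sp4 Y -> X != 0 -> Y \notin <[X]>%VS ->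
  X *m X = 0 -> Y *m X = 0 -> X *m Y = 0 -> Y *m Y = 0 ->
  exists2 M : 'M[C]_(2, 4), row_free M & [/\ M *m J *m M^T = 0,
    M *m X = 0 & M *m Y = 0].
Proof.
move=> spX spY X0 nYX XX YX XY YY.
have [i ri] : exists i, row i X != 0.
  apply: contrapT => all0; move/negP: X0; apply; apply/eqP/row_matrixP=> i.
  by rewrite row0; apply/eqP/negPn/negP=> ne0; apply: all0; exists i.
(* If all rows of [X] and [Y] lay on the line of [row i X], both would be multiples of one rank-one
   matrix, contrary to their independence. So [X] or [Y], called [Z], supplies a second independent
   row. *)
have [Z [j nZu [ZX XZ ZY ZZ]]] : exists Z, exists2 j,
    ~~ (row j Z <= row i X)%MS &
    [/\ Z *m X = 0, X *m Z = 0, Z *m Y = 0 & in_sp4 Z /\ Z *m Z = 0].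
  have [Xu|/row_subPn[j nXu]] := boolP (X <= row i X)%MS; last by exists X, j.
  have [Yu|/row_subPn[j nYu]] := boolP (Y <= row i X)%MS; last by exists Y, j.
  have [k eqX] := sp4_rank1 spX ri Xu; have [l eqY] := sp4_rank1 spY ri Yu.
  case/negP: nYX; apply/vlineP; exists (l / k).
  rewrite eqX eqY scalerA mulfVK //.
  by apply: contraNneq X0 => k0; rewrite eqX k0 scale0r.
exists (col_mx (row i X) (row j Z)).
  have := @rank_ltmx _ _ _ _ (row i X) (col_mx (row i X) (row j Z)).
  rewrite rank_rV ri -row_leq_rank; apply.
  by rewrite /ltmx col_mx_sub submx_refl nZu -addsmxE addsmxSl.
(* Skew-adjointness moves [V] to the other side of the form, where the zero product [W *m V]
   appears. *)
have om0 W V k l : in_sp4 V -> W *m V = 0 -> om (row k W) (row l V) = 0.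
  by move=> spV WV; rewrite !rowE omC om_sp4 // opprK
    -mulmxA WV mulmx0 omC om0l oppr0.
have [spZ Z2] := ZZ.
split; first by rewrite col_om !om0 // -mx22_0.
- by rewrite (@mul_col_mx _ 1 1 4 4) !rowE -!mulmxA XX ZX !mulmx0 col_mx0.
- by rewrite (@mul_col_mx _ 1 1 4 4) !rowE -!mulmxA XY ZY !mulmx0 col_mx0.
Qed.

(** * Pencils of symmetric 2x2 matrices under congruence *)

Lemma sym_mx22 B : B^T = B -> exists p q r, B = mx22 p q q r.
Proof.
move=> BT; exists (B 0 0), (B 0 1), (B 1 1).
have B10 : B 1 0 = B 0 1 by rewrite -[in LHS]BT mxE.
by rewrite [LHS]mx22_eta B10.
Qed.

Lemma conj_siegel (M N : 'M[C]_(2, 4)) (X : 'M[C]_4) :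
  in_Sp4 (col_mx N M : 'M_4) -> in_sp4 X -> M *m X = 0 ->
  exists p q r, conj_lfun (col_mx N M : 'M_4) X = block 0 (mx22 p q q r) 0 0.
Proof.
move=> gS spX MX; have spC := in_sp4_conj gS spX.
have [A [B [D [G eqX]]]] := block_eta (conj_lfun (col_mx N M : 'M_4) X).
have [D0 G0] : 0 = D /\ 0 = G.
  move: eqX; rewrite conj_lfunE (@mul_col_mx _ 2 2 4 4) MX.
  rewrite (@mul_col_mx _ 2 2 4 4) mul0mx => /(@eq_col_mx _ 2 2 4)[_].
  by rewrite -(@row_mx0 _ 2 2 2) => /(@eq_row_mx _ 2 2 2).
move: spC; rewrite eqX -D0 -G0 => /in_sp4_block[BT _ A0].
have {}A0 : A = 0 by rewrite -[A]trmxK -[A^T]opprK -A0 oppr0 trmx0.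
by have [p [q [r ->]]] := sym_mx22 BT; exists p, q, r; rewrite A0.
Qed.

(** Containment in the abelian nilradical of the Siegel parabolic, which is the space of symmetric
    2x2 matrices. *)
Definition siegel (h : {vspace 'M[C]_4}) := forall X, X \in h ->
  exists p q r, X = block 0 (mx22 p q q r) 0 0.

Lemma square0_siegel (h : {vspace 'M[C]_4}) :
  (forall X, X \in h -> in_sp4 X) -> \dim h = 2%N ->
  (forall X Y, X \in h -> Y \in h -> X *m Y = 0) ->
  exists2 g, in_Sp4 g & siegel (conj_lfun g @: h).
Proof.
move=> sph dimh h0.
have /eqP : vpick h != 0 by rewrite vpick0 -dimv_eq0 dimh.
move/eqP=> X0; have Xh := memv_pick h.
have [Y hE nYX] := span2_extend dimh Xh X0.
have Yh : Y \in h by rewrite hE memv_span // !inE eqxx orbT.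
have [||||||M Mfree [MM MX MY]] := isotropic_pair_killed _ _ X0 nYX;
  try exact: sph; try exact: h0.
have [N gS] := symplectic_completion Mfree MM.
exists (col_mx N M : 'M_4) => // _ /memv_imgP[Z Zh ->].
apply: conj_siegel => //; first exact: sph.
move: Zh; rewrite hE => /memv_span2P[a [b ->]].
by rewrite mulmxDr -!scalemxAr MX MY !scaler0 addr0.
Qed.

(** The Levi factor GL(2) of the Siegel parabolic acts on its nilradical by congruence. *)
Lemma levi_conj (P : 'M[C]_2) : P \in unitmx ->
  exists2 g, in_Sp4 g & forall B,
    conj_lfun g (block 0 B 0 0) = block 0 (P *m B *m P^T) 0 0.
Proof.
move=> Pu; have PTu : P^T \in unitmx by rewrite unitmx_tr.
have gS : in_Sp4 (block P 0 0 (invmx P^T)).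
  apply: in_Sp4P; rewrite tr_block !mul_block !trmx0 trmx_inv trmxK.
  rewrite !(mulmx0, mul0mx, mulmx1, addr0, add0r, mulmxN, mulNmx).
  by rewrite mulmxV // mulVmx.
exists (block P 0 0 (invmx P^T)) => // B.
apply: conj_lfun_eq; first by case: gS.
by rewrite !mul_block !(mulmx0, mul0mx, addr0, add0r) mulmxK.
Qed.

Lemma siegel_levi (P : 'M[C]_2) (h : {vspace 'M[C]_4}) g :
  (forall B, conj_lfun g (block 0 B 0 0) = block 0 (P *m B *m P^T) 0 0) ->
  siegel h -> siegel (conj_lfun g @: h).
Proof.
move=> gE sh _ /memv_imgP[X /sh[p [q [r ->]]] ->]; rewrite gE.
have /sym_mx22[p' [q' [r' ->]]] :
  (P *m mx22 p q q r *m P^T)^T = P *m mx22 p q q r *m P^T.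
  by rewrite !trmx_mul trmxK tr_mx22 mulmxA.
by exists p', q', r'.
Qed.

Lemma quadratic_root (a b c : C) : a != 0 ->
  exists t, a * t ^+ 2 + b * t + c = 0.
Proof.
move=> a0; pose d : C := sqrtC (b ^+ 2 - 4%:R * a * c).
have d2 : d ^+ 2 = b ^+ 2 - 4%:R * a * c by rewrite sqrtCK.
exists ((d - b) / (2%:R * a)); move: d2; move: d => d d2.
have -> : c = (b ^+ 2 - d ^+ 2) / (4%:R * a) by rewrite d2; field.
by field.
Qed.

Lemma siegel_degenerate (h : {vspace 'M[C]_4}) : \dim h = 2%N -> siegel h ->
  exists p q r, [/\ block 0 (mx22 p q q r) 0 0 \in h,
    block 0 (mx22 p q q r) 0 0 != 0 :> 'M_4 & p * r = q ^+ 2].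
Proof.
move=> dimh sh.
have Z0 : vpick h != 0 by rewrite vpick0 -dimv_eq0 dimh.
have Zh := memv_pick h.
have [Y hE nYZ] := span2_extend dimh Zh Z0.
have Yh : Y \in h by rewrite hE memv_span // !inE eqxx orbT.
have [p [q [r eqZ]]] := sh _ Zh; have [p' [q' [r' eqY]]] := sh _ Yh.
have [d0|dn0] := eqVneq (p * r - q ^+ 2) 0.
  exists p, q, r; rewrite -eqZ; split=> //; exact: subr0_eq.
(* The determinant of [Y] plus [t] times the first basis element is quadratic in [t], with the
   nonzero determinant of the latter as leading coefficient. At a root the sum is singular, and it
   is nonzero by independence. *)
have [t ht] := quadratic_root (p * r' + r * p' - 2%:R * q * q')
  (p' * r' - q' ^+ 2) dn0.
have eqYZ : Y + t *: vpick h = block 0 (mx22 (p' + t * p) (q' + t * q)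
    (q' + t * q) (r' + t * r)) 0 0.
  by rewrite eqY eqZ scale_block add_block scale_mx22 add_mx22 !scaler0 !addr0.
exists (p' + t * p), (q' + t * q), (r' + t * r); rewrite -eqYZ.
split; first by rewrite memvD ?memvZ.
  apply: contraNneq nYZ => /eqP; rewrite addr_eq0 => /eqP->.
  by rewrite -scaleNr memvZ ?memv_line.
by apply/eqP; rewrite -subr_eq0 -[X in _ == X]ht; apply/eqP; ring.
Qed.

Lemma siegel_contains_X_a (h : {vspace 'M[C]_4}) :
  \dim h = 2%N -> siegel h -> exists g, [/\ in_Sp4 g,
    siegel (conj_lfun g @: h) &
    block 0 (mx22 0 0 0 1) 0 0 \in (conj_lfun g @: h)%VS].
Proof.
move=> dimh sh; have [p [q [r [Zh Z0 pr]]]] := siegel_degenerate dimh sh.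
have [P Pu [k k0 Pk]] : exists2 P : 'M[C]_2, P \in unitmx & exists2 k : C,
    k != 0 & P *m mx22 p q q r *m P^T = mx22 0 0 0 k.
  have [p0|p0] := eqVneq p 0.
    have q0 : q = 0.
      by apply/eqP; rewrite -sqrf_eq0 -pr p0 mul0r.
    exists 1%:M; first exact: unitmx1.
    exists r; last by rewrite trmx1 mul1mx mulmx1 p0 q0.
    by apply: contraNneq Z0 => r0; rewrite p0 q0 r0 -mx22_0 -block_0.
  (* The first row [(q, -p)] spans the kernel of the singular matrix; the second picks out its entry
     [p]. *)
  exists (mx22 q (- p) 1 0).
    by rewrite unitmxE det_mx22 unitfE mulr0 sub0r mulr1 opprK.
  exists p => //; rewrite tr_mx22 !mul_mx22.
  have -> : r = q ^+ 2 / p by rewrite -pr mulrC mulKf.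
  by congr mx22; field.
have [g gS gE] := levi_conj Pu.
exists g; split=> //; first exact: siegel_levi gE sh.
have -> : block 0 (mx22 0 0 0 1) 0 0 =
    k^-1 *: block 0 (mx22 0 0 0 k) 0 0 :> 'M_4.
  by rewrite scale_block scale_mx22 !scaler0 !mulr0 mulVf.
by rewrite memvZ // -Pk -gE memv_img.
Qed.

Lemma siegel_X_a_conjugate (h : {vspace 'M[C]_4}) :
  \dim h = 2%N -> siegel h -> block 0 (mx22 0 0 0 1) 0 0 \in h ->
  exists i, Sp4_conjugate h (nil_rep R i).
Proof.
move=> dimh sh Zh.
have Z0 : block 0 (mx22 0 0 0 1) 0 0 != 0 :> 'M[C]_4.
  rewrite block_0 mx22_0; apply/eqP=> /block_inj[_ e _ _].
  by have [_ _ _ /eqP] := mx22_inj e; rewrite oner_eq0.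
have [Y hE _] := span2_extend dimh Zh Z0.
have Yh : Y \in h by rewrite hE memv_span // !inE eqxx orbT.
have [p [q [r eqY]]] := sh _ Yh.
have hP X : X \in h -> exists a b : C,
    X = block 0 (mx22 (b * p) (b * q) (b * q) (a + b * r)) 0 0.
  rewrite hE => /memv_span2P[a [b ->]]; exists a, b.
  rewrite eqY !scale_block add_block !scale_mx22 add_mx22 !scaler0 !addr0.
  by rewrite !mulr0 !add0r mulr1.
(* The case [p = 0] is the tangent pencil, already in normal form. Otherwise the shear by
   [- (q / p)] clears the off-diagonal entry of [Y] and fixes [X_a]. *)
have [p0|p0] := eqVneq p 0.
  exists 0; apply: (Sp4_conjugateP (g := 1%:M)); rewrite ?dim_nil_rep //.
    by apply: in_Sp4P; rewrite trmx1 mul1mx mulmx1.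
  move=> X /hP[a [b ->]]; apply/mem_nil_rep0; exists (a + b * r), (b * q).
  by rewrite conj_lfunE mul1mx invmx1 mulmx1 p0 mulr0.
have Pu : mx22 1 0 (- (q / p)) 1 \in unitmx.
  by rewrite unitmxE det_mx22 mul0r subr0 mulr1 unitr1.
have [g gS gE] := levi_conj Pu.
exists 1; apply: (Sp4_conjugateP gS); rewrite ?dim_nil_rep //.
move=> X /hP[a [b ->]]; apply/mem_nil_rep1.
exists (a + b * r - b * q ^+ 2 / p), (b * p).
rewrite gE tr_mx22 !mul_mx22.
by apply: (congr1 (fun B => block 0 B 0 0)); congr mx22; field.
Qed.

(** * Assembling the classification *)

Lemma nilpotent_dim2_conjugate (h : {vspace 'M[C]_4}) :
  sp4_subalgebra h -> \dim h = 2%N -> all_nilpotent h ->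
  exists i, Sp4_conjugate h (nil_rep R i).
Proof.
move=> alg dimh nilh; have hC := nilpotent_dim2_abelian alg dimh nilh.
have sph X : X \in h -> in_sp4 X by case: alg => + _; apply.
have [[X Xh X3]|cube0] := pselect (exists2 X, X \in h & X *m X *m X != 0).
  have [g gS gX] := regular_nilpotent_conj (sph _ Xh) (nilh _ Xh) X3.
  exists ord_max; apply: (Sp4_conjugateP gS); rewrite ?dim_nil_rep // => Y Yh.
  have gu : g \in unitmx by case: gS.
  (* All of [h] commutes with [X], so its conjugate lies in the centralizer of the normal form;
     equal dimensions give equality. *)
  apply: regular_nilpotent_centralizer; first exact: in_sp4_conj (sph _ Yh).
  by rewrite -gX -!conj_lfunM // hC.
have sqr0 X : X \in h -> X *m X = 0.
  move=> Xh; apply: cube0_sqr0; first exact: sph.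
  by apply/eqP/negPn/negP=> X3; apply: cube0; exists X.
(* Polarization: for commuting [X] and [Y], the square of [X + Y] reduces to twice [X *m Y]. *)
have mul0 X Y : X \in h -> Y \in h -> X *m Y = 0.
  move=> Xh Yh; have := sqr0 _ (memvD Xh Yh).
  rewrite mulmxDl !mulmxDr !sqr0 // add0r addr0 (hC Y X) // => /eqP.
  by rewrite -mulr2n -scaler_nat scaler_eq0 pnatr_eq0 => /eqP.
have [g gS sg] := square0_siegel sph dimh mul0.
have dimg g' (k : {vspace 'M[C]_4}) :
    in_Sp4 g' -> \dim (conj_lfun g' @: k) = \dim k.
  by case=> gu _; rewrite dim_conj.
have [g1 [g1S sg1 mg1]] := siegel_contains_X_a (etrans (dimg _ _ gS) dimh) sg.
have [|i ci] := siegel_X_a_conjugate _ sg1 mg1; first by rewrite !dimg.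
exists i; apply: Sp4_conjugate_trans (ci).
by apply: (Sp4_conjugate_trans (h2 := (conj_lfun g @: h)%VS));
  [exists g|exists g1].
Qed.
End Sp4Nilpotent.

Theorem theorem6p10 (R : realType) :
  (forall i : 'I_3,
     abelian_subalgebra (nil_rep R i) /\
     \dim (nil_rep R i) = 2%N /\ all_nilpotent (nil_rep R i)) /\
  (forall i j : 'I_3,
     i <> j -> ~ Sp4_conjugate (nil_rep R i) (nil_rep R j)) /\
  (forall h : {vspace 'M[R[i]]_4},
     sp4_subalgebra h -> \dim h = 2%N -> all_nilpotent h ->
     exists! i : 'I_3, Sp4_conjugate h (nil_rep R i)).
Proof.
split=> [i|].
  split; first exact: nil_rep_abelian.
  by split; [exact: dim_nil_rep|exact: nil_rep_nilpotent].
split=> [|h alg dimh nilh]; first exact: nil_rep_not_conjugate.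
have [i hi] := nilpotent_dim2_conjugate alg dimh nilh.
exists i; split=> // j hj; apply: contrapT => /nil_rep_not_conjugate; apply.
exact: Sp4_conjugate_trans (Sp4_conjugate_sym hi) hj.
Qed.
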